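(* Let $n$ be a positive even integer and let $A$ be an adjacency matrix of the $n$-cube graph $Q_n$. Then for every integer $i\geq 0$, the multiplicity of $2^i$ as a $2$-elementary divisor of $A$ is equal to the number of eigenvalues of $A$ (counted with multiplicity) whose exact $2$-power divisor is $2^{i+1}$, i.e. the number of eigenvalues that are divisible by $2^{i+1}$ and not by $2^{i+2}$.
   Context: The $n$-cube graph $Q_n$ has vertex set $\{0,1\}^n$, with two vertices joined by an edge if and only if the $n$-tuples differ in exactly one component. All eigenvalues of $A$ are integers. For a prime $p$ and an integer $i\ge 0$, the multiplicity of $p^i$ as a $p$-elementary divisor of an integral matrix $X$ is the number of nonzero diagonal entries of the Smith normal form of $X$ (equivalently, of any diagonal matrix equivalent to $X$ over $\mathbb{Z}$, or over the localization $\mathbb{Z}_{(p)}$) that are divisible by $p^i$ but not by $p^{i+1}$. *)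

(* Defs.v *)
From HB Require Import structures.
From mathcomp Require Import all_boot all_order all_algebra all_field.

Set Implicit Arguments.
Unset Strict Implicit.
Unset Printing Implicit Defensive.

Import Order.TTheory GRing.Theory Num.Theory.
Local Open Scope ring_scope.

Definition cube_adj (n : nat) : rel (n.-tuple bool) :=
  fun x y => #|[set k : 'I_n | tnth x k != tnth y k]| == 1%N.

(* An enumeration of the vertices is needed to write the adjacency relation as
   a matrix; different bijections v give the different adjacency matrices of
   the same graph. *)
Definition adjacency_matrix (T : Type) (e : rel T) (N : nat) (v : 'I_N -> T) :
    'M[int]_N :=
  \matrix_(i, j) (e (v i) (v j))%:R.

(* The diagonal entries are not required to be nonnegative: D is a Smith normal
   form in the usual sense up to signs, which divisibility does not see. *)
Definition smith_normal_form (N : nat) (X D : 'M[int]_N) : Prop :=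
  [/\ is_diag_mx D,
      forall i j : 'I_N, (i <= j)%N -> (D i i %| D j j)%Z
    & exists L R : 'M[int]_N,
        [/\ L \in unitmx, R \in unitmx & X = L *m D *m R]].

Lemma smith_normal_form_exists (N : nat) (X : 'M[int]_N) :
  exists D, smith_normal_form X D.
Proof.
have [L uL [R uR [d sd XE]]] := int_Smith_normal_form X.
exists (\matrix_(i, j) (d`_i *+ (i == j :> nat))); split; last by exists L, R.
- by apply/is_diag_mxP=> i j neq_ij; rewrite mxE (negbTE neq_ij).
- move=> i j le_ij; rewrite !mxE !eqxx !mulr1n.
  have [lt_jd|le_dj] := ltnP j (size d); last by rewrite (nth_default 0 le_dj) dvdz0.
  have lt_id := leq_ltn_trans le_ij lt_jd.
  by apply: (sorted_leq_nth dvdz_trans dvdzz 0 sd).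
Qed.

(* The multiplicity of p ^ i as a p-elementary divisor of any X having D as its
   Smith normal form. *)
Definition elementary_divisor_mult (p i N : nat) (D : 'M[int]_N) : nat :=
  #|[set k : 'I_N | [&& D k k != 0, ((p ^ i)%N %| D k k)%Z
                      & ~~ ((p ^ i.+1)%N %| D k k)%Z]]|.

(* The complex eigenvalues, each repeated according to its multiplicity as a
   root of the characteristic polynomial (see eigenvaluesP). *)
Definition eigenvalues (N : nat) (X : 'M[int]_N) : seq algC :=
  sval (closed_field_poly_normal (char_poly (map_mx intr X : 'M[algC]_N))).

Lemma eigenvaluesP (N : nat) (X : 'M[int]_N) :
  char_poly (map_mx intr X : 'M[algC]_N)
    = \prod_(z <- eigenvalues X) ('X - z%:P).
Proof.
rewrite /eigenvalues; case: closed_field_poly_normal => s /= {1}->.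
by rewrite (monicP (char_poly_monic _)) scale1r.
Qed.

(* The notation %| of C_scope means "is an integer multiple of"; in particular
   the eigenvalue 0 is never counted. *)
Definition eigenvalue_exact_count (p i N : nat) (X : 'M[int]_N) : nat :=
  count (fun z : algC => ((p ^ i)%N %| z)%C && ~~ ((p ^ i.+1)%N %| z)%C)
        (eigenvalues X).

(* Main.v *)
(* Let n = 2m.  In the basis dual to the squarefree monomials, A becomes the
   operator 2(m - k) + U on the span M_k of the k-subsets, where U adds one
   element in all possible ways.  As the scalar vanishes on M_m, this operator
   is the direct sum of a map from the levels < m to the levels <= m and of a
   map from the levels >= m to the levels > m; up to signs, complementation of
   subsets turns the second into the transpose of the first.

   For a j-subset b let U_t b be the sum of its supersets of size j + t, so
   that U (U_t b) = (t + 1) U_(t+1) b.  When b runs over the bottoms of the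
   chains of the Greene-Kleitman symmetric chain decomposition, the U_t b with
   t <= n - 2j form a Z-basis.  With r = m - j, set
     g_t = sum_i 2^i C(r + i, i) U_(t-i) b,
     h_t = sum_i 2^i C(r + i - 1, i) U_(t-i) b;
   then the operator maps g_t to (t + 1) h_(t+1), so it is equivalent over Z to
   the diagonal matrix of these factors, that is, of the halves m - k of the
   eigenvalues. *)
Require Import Defs.
From HB Require Import structures.
From mathcomp Require Import all_boot all_order all_algebra all_field.
From mathcomp Require Import perm zify ring.

Set Implicit Arguments.
Unset Strict Implicit.
Unset Printing Implicit Defensive.

Import Order.TTheory GRing.Theory Num.Theory.
Local Open Scope ring_scope.

(** * Sums over the cube, Hamming distance and the adjacency kernel *)

Fixpoint wt (s : seq bool) : nat := if s is x :: s' then (x + wt s')%N else 0%N.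

Local Notation "u \sub w" := (all2 implb u w) (at level 70).

Lemma sum_cubeS (V : nmodType) (n : nat) (F : seq bool -> V) :
  \sum_(u : n.+1.-tuple bool) F u
    = \sum_(u : n.-tuple bool) F (false :: u)
      + \sum_(u : n.-tuple bool) F (true :: u).
Proof.
pose c (p : bool * n.-tuple bool) : n.+1.-tuple bool := [tuple of p.1 :: p.2].
rewrite (reindex c) /=; last first.
  exists (fun u => (thead u, [tuple of behead u])) => [[x u] _|u _].
    by congr pair; apply: val_inj.
  by rewrite /c /= -tuple_eta.
rewrite -(pair_bigA _ (fun x (u : n.-tuple bool) => F (x :: u))) /=.
by rewrite big_bool addrC.
Qed.

Arguments sum_cubeS {V n} F.

Lemma sum_cube0 (V : nmodType) (F : seq bool -> V) :
  \sum_(u : 0.-tuple bool) F u = F [::].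
Proof.
rewrite (bigD1 [tuple]) //= big1 ?addr0 // => u /eqP[].
by rewrite tuple0.
Qed.

Lemma sum_delta (n : nat) (F : seq bool -> int) (w : n.-tuple bool) :
  \sum_(u : n.-tuple bool) (val u == val w)%:R * F u = F w.
Proof.
rewrite (bigD1 w) //= eqxx mul1r big1 ?addr0 // => u /negbTE neq_uw.
by rewrite val_eqE neq_uw mul0r.
Qed.

Lemma sum_deltar (n : nat) (F : seq bool -> int) (w : n.-tuple bool) :
  \sum_(u : n.-tuple bool) F u * (val u == val w)%:R = F w.
Proof.
rewrite -[RHS](sum_delta F); apply: eq_bigr => u _.
by rewrite mulrC.
Qed.

Definition hdist (u w : seq bool) : nat := count (fun p => p.1 != p.2) (zip u w).

Lemma hdist0 (n : nat) (u w : n.-tuple bool) :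
  (hdist u w == 0) = (val u == val w).
Proof.
elim: n u w => [|n IHn] u w; first by rewrite (tuple0 u) (tuple0 w).
case/tupleP: u => x u; case/tupleP: w => y w.
rewrite eqseq_cons -IHn /hdist /= addn_eq0.
by case: x; case: y.
Qed.

Definition adj (u w : seq bool) : int := (hdist u w == 1%N)%:R.

Lemma adj_cons (n : nat) (x y : bool) (u w : n.-tuple bool) :
  adj (x :: u) (y :: w) = if x == y then adj u w else (val u == val w)%:R.
Proof.
rewrite -hdist0 /adj {1}/hdist /= -/(hdist u w).
by case: x; case: y; rewrite ?add0n ?add1n ?eqSS.
Qed.

Lemma cube_adjE (n : nat) (u w : n.-tuple bool) :
  (cube_adj u w)%:R = adj u w.
Proof.
rewrite /cube_adj /adj; congr ((_ == _)%:R).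
rewrite -sum1dep_card big_mkcond /=.
elim: n u w => [|n IHn] u w; first by rewrite big_ord0 (tuple0 u) (tuple0 w).
case/tupleP: u => x u; case/tupleP: w => y w.
rewrite big_ord_recl /hdist /= -/(hdist u w) -IHn.
rewrite !tnth0; congr (_ + _)%N.
by apply: eq_bigr => i _; rewrite !tnthS.
Qed.

(** * Weights, inclusion of words and the raising operator *)

Lemma wt_size (n : nat) (u : n.-tuple bool) : (wt u <= n)%N.
Proof.
rewrite -[X in (_ <= X)%N](size_tuple u).
by elim: {u}(tval u) => //= x s IHs; rewrite -add1n leq_add ?leq_b1.
Qed.

(* Words stand for subsets; this is the coefficient of w in U_t b. *)
Definition above (b : seq bool) (t : nat) (w : seq bool) : int :=
  ((b \sub w) && (wt w == wt b + t)%N)%:R.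

Lemma above_FF b t w : above (false :: b) t (false :: w) = above b t w.
Proof. by []. Qed.
Lemma above_FT b t w : above (false :: b) t.+1 (true :: w) = above b t w.
Proof. by rewrite /above /= !add0n add1n addnS eqSS. Qed.
Lemma above_F0T b w : above (false :: b) 0 (true :: w) = 0.
Proof.
rewrite /above /= !add0n add1n addn0.
suff le_bw: b \sub w -> (wt b <= wt w)%N.
  by case: (boolP (_ \sub _)) => //= /le_bw; rewrite -ltnS => /gtn_eqF->.
elim: b w => [|x b IHb] [|y w] //= /andP[xy /IHb].
by case: x xy; case: y => //=; lia.
Qed.
Lemma above_TF b t w : above (true :: b) t (false :: w) = 0.
Proof. by []. Qed.
Lemma above_TT b t w : above (true :: b) t (true :: w) = above b t w.
Proof. by rewrite /above /= !add1n addSn eqSS. Qed.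

Lemma above_wt b t w : wt w != (wt b + t)%N -> above b t w = 0.
Proof. by rewrite /above => /negbTE->; rewrite andbF. Qed.

Lemma above0 (n : nat) (b w : n.-tuple bool) : above b 0 w = (val b == val w)%:R.
Proof.
elim: n b w => [|n IHn] b w; first by rewrite (tuple0 b) (tuple0 w).
case/tupleP: b => x b; case/tupleP: w => y w.
rewrite /= eqseq_cons.
by case: x; case: y; rewrite ?above_FF ?above_F0T ?above_TF ?above_TT ?IHn.
Qed.

(** If w has t + 1 elements outside b, the words between b and w one level below w arise by removing
    one of these elements. *)
Lemma above_up (n : nat) (b w : n.-tuple bool) (t : nat) :
  \sum_(u : n.-tuple bool) above b t u * above u 1 w
    = t.+1%:R * above b t.+1 w.
Proof.
elim: n b w t => [|n IHn] b w t.
  rewrite (sum_cube0 (fun u => above b t u * above u 1 w)) (tuple0 b) (tuple0 w) /above /=.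
  by rewrite !mulr0.
case/tupleP: b => x b; case/tupleP: w => y w.
rewrite (sum_cubeS (fun u => above (x :: b) t u * above u 1 (y :: w))) /=.
case: x; case: y.
- under eq_bigr => u _ do rewrite above_TF mul0r.
  under [X in _ + X]eq_bigr => u _ do rewrite !above_TT.
  by rewrite IHn above_TT big1 ?add0r.
- under eq_bigr => u _ do rewrite above_TF mul0r.
  under [X in _ + X]eq_bigr => u _ do rewrite above_TF mulr0.
  by rewrite !big1 ?add0r ?mulr0.
- under eq_bigr => u _ do rewrite above_FF above_FT above0.
  rewrite (sum_deltar (above b t)).
  under eq_bigr => u _ do rewrite above_TT.
  rewrite above_FT; case: t => [|t].
    by rewrite big1 ?addr0 ?mul1r // => u _; rewrite above_F0T mul0r.
  under eq_bigr => u _ do rewrite above_FT.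
  by rewrite IHn -[X in X + _]mul1r -mulrDl -(natrD _ 1) add1n.
- under eq_bigr => u _ do rewrite !above_FF.
  under [X in _ + X]eq_bigr => u _ do rewrite above_TF mulr0.
  by rewrite IHn above_FF big1 ?addr0.
Qed.

(* The operator c - 2k + U; it is A in the basis dual to the squarefree
   monomials when c is the number of letters (adj_zeta). *)
Definition tri (c : int) (u w : seq bool) : int :=
  (c - 2 * (wt u)%:R) * (u == w)%:R + above u 1 w.

Lemma above_tri (n : nat) (c : int) (b w : n.-tuple bool) (t : nat) :
  \sum_(u : n.-tuple bool) above b t u * tri c u w
    = (c - 2 * (wt b + t)%:R) * above b t w + t.+1%:R * above b t.+1 w.
Proof.
under eq_bigr => u _ do rewrite mulrDr mulrCA mulrA [X in X + _]mulrC.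
rewrite big_split /= above_up; congr (_ + _).
rewrite (sum_delta (fun u => (c - 2 * (wt u)%:R) * above b t u)).
have [->//|/above_wt->] := eqVneq (wt w) (wt b + t)%N.
by rewrite !mulr0.
Qed.

(** * Möbius inversion and the change of basis *)

Definition zeta (u w : seq bool) : int := (w \sub u)%:R.
Definition mobius (u w : seq bool) : int := (-1) ^+ (wt u + wt w) * (w \sub u)%:R.

Lemma zeta_mobius (n : nat) (u w : n.-tuple bool) :
  \sum_(x : n.-tuple bool) zeta u x * mobius x w = (val u == val w)%:R.
Proof.
elim: n u w => [|n IHn] u w.
  by rewrite (sum_cube0 (fun x => zeta u x * mobius x w)) (tuple0 u) (tuple0 w).
case/tupleP: u => x u; case/tupleP: w => y w.
rewrite (sum_cubeS (fun v => zeta (x :: u) v * mobius v (y :: w))) /= eqseq_cons.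
rewrite /zeta /mobius /= in IHn *.
case: x; case: y => /=.
- rewrite big1 ?add0r => [|v _]; last by rewrite !mulr0.
  by rewrite -IHn; apply: eq_bigr => v _; rewrite !add1n addnS !exprS; ring.
- by rewrite -big_split big1 //= => v _; rewrite add0n !add1n addSn exprS; ring.
- by rewrite -big_split big1 //= => v _; rewrite !mulr0 mul0r addr0.
- by rewrite [X in _ + X]big1 ?addr0 => [|v _]; rewrite ?mul0r // -IHn.
Qed.

(** Both operators are sums over the letters of one-letter operators, and [zeta] is a tensor power
    of its one-letter case. Splitting off the first letter therefore reduces the identity to 2 by 2
    matrices. *)
Lemma adj_zeta (n : nat) (u w : n.-tuple bool) :
  \sum_(x : n.-tuple bool) adj u x * zeta x w
    = \sum_(x : n.-tuple bool) zeta u x * tri n%:R x w.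
Proof.
have triE k c (x v : k.-tuple bool) :
    tri (1 + c) x v = (x == v)%:R + tri c x v.
  by rewrite /tri -addrA mulrDl mul1r addrA val_eqE.
elim: n u w => [|n IHn] u w.
  rewrite (sum_cube0 (fun x => adj u x * zeta x w)).
  by rewrite (sum_cube0 (fun x => zeta u x * tri 0 x w)) (tuple0 u) (tuple0 w).
case/tupleP: u => x u; case/tupleP: w => y w.
rewrite (sum_cubeS (fun v => adj (x :: u) v * zeta v (y :: w))).
rewrite (sum_cubeS (fun v => zeta (x :: u) v * tri n.+1%:R v (y :: w))) /=.
have E1 z : \sum_(v : n.-tuple bool) adj (x :: u) (z :: v) * zeta (z :: v) (y :: w)
    = (y ==> z)%:R * (if x == z then \sum_(v : n.-tuple bool) adj u v * zeta v w
                      else zeta u w).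
  rewrite /zeta /=; case: ifP => [xz|nxz].
    rewrite mulr_sumr; apply: eq_bigr => v _; rewrite adj_cons xz.
    by case: (y ==> z) => /=; rewrite ?mul1r ?mul0r ?mulr0.
  rewrite -[(w \sub u)%:R](sum_delta (fun v => (w \sub v)%:R)) mulr_sumr.
  apply: eq_bigr => v _; rewrite adj_cons nxz [val v == _]eq_sym.
  by case: (y ==> z) => /=; rewrite ?mul1r ?mul0r ?mulr0.
have E2 z : \sum_(v : n.-tuple bool) zeta (x :: u) (z :: v) * tri n.+1%:R (z :: v) (y :: w)
    = (z ==> x)%:R * ((y == z)%:R * (\sum_(v : n.-tuple bool) zeta u v * tri n%:R v w
          + (1 - 2 * z%:R) * zeta u w) + (~~ z && y)%:R * zeta u w).
  transitivity (\sum_(v : n.-tuple bool) (z ==> x)%:R *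
      ((y == z)%:R * (zeta u v * tri n%:R v w)
       + ((y == z)%:R * (1 - 2 * z%:R) + (~~ z && y)%:R)
         * (zeta u v * (val v == val w)%:R))); last first.
    by rewrite -mulr_sumr big_split -!mulr_sumr (sum_deltar (zeta u)) /=; ring.
  apply: eq_bigr => v _.
  rewrite {1}/zeta /= -mulnb natrM -/(zeta u v).
  rewrite /tri eqseq_cons /= natrD -[n.+1]add1n natrD.
  case: (y) z => -[] /=.
  - by rewrite above_TT; ring.
  - by rewrite above_FT above0; ring.
  - by rewrite above_TF; ring.
  - by rewrite above_FF; ring.
rewrite !E1 !E2 IHn; case: x {E1 E2}; case: y => /=; ring.
Qed.

(** * Symmetric chains by bracket matching *)

(* Reading 0 as an opening and 1 as a closing bracket, from the last letter to
   the first, bot s keeps only the matched 1s of s: it is the bottom of the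
   symmetric chain of s.  The test says that an unmatched 0 is left, since
   size s' - wt s' zeros occur and wt (bot s') of them are matched. *)
Fixpoint bot (s : seq bool) : seq bool :=
  if s is x :: s' then (x && (wt (bot s') + wt s' != size s')%N) :: bot s'
  else [::].

Lemma size_bot s : size (bot s) = size s.
Proof. by elim: s => //= x s ->. Qed.

Lemma size_bot_tuple n (s : n.-tuple bool) : size (bot s) == n.
Proof. by rewrite size_bot size_tuple. Qed.
Canonical bot_tuple n (s : n.-tuple bool) := Tuple (size_bot_tuple s).

Lemma wt_bot s : (wt (bot s) <= wt s)%N /\ (wt (bot s) + wt s <= size s)%N.
Proof.
elim: s => //= x s [le1 le2].
by case: x => /=; [case: eqP => /=|]; lia.
Qed.

(** A chain meets every level from that of its bottom b to the complementary one. A matched first 1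
    is forced; otherwise the first letter is 0 as long as the chain of the tail reaches level k, and
    1 one step above the top of that chain. *)
Lemma bot_level s k : (wt (bot s) <= k)%N -> (k + wt (bot s) <= size s)%N ->
  exists s', [/\ size s' = size s, bot s' = bot s & wt s' = k].
Proof.
elim: s k => [|x s IHs] k /=.
  by move=> _; rewrite addn0 leqn0 => /eqP->; exists [::].
have [leb leq] := wt_bot s.
set e := x && _; case: (boolP e) => [ee|_] lek ltk.
  have [||s' [szs bots wts]] := IHs k.-1; [lia|lia|].
  exists (true :: s'); split; rewrite /= ?szs ?bots ?wts //; last by lia.
  by congr (_ :: _); apply/eqP; lia.
have [le_ks|lt_sk] := leqP (k + wt (bot s)) (size s).
  have [||s' [szs bots wts]] := IHs k; [lia|lia|].
  by exists (false :: s'); split; rewrite /= ?szs ?bots ?wts.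
have [||s' [szs bots wts]] := IHs k.-1; [lia|lia|].
exists (true :: s'); split; rewrite /= ?szs ?bots ?wts //; last by lia.
by congr (_ :: _); apply/negbTE; rewrite negbK; apply/eqP; lia.
Qed.

Lemma bot_level_tuple n (s : n.-tuple bool) k :
    (wt (bot s) <= k)%N -> (k + wt (bot s) <= n)%N ->
  exists s' : n.-tuple bool, bot s' = bot s /\ wt s' = k.
Proof.
move=> lebk lek; have [||s' [/eqP szs bots wts]] := @bot_level s k => //.
  by rewrite size_tuple.
by rewrite size_tuple in szs; exists (Tuple szs).
Qed.

(** * Integral spans *)

(* Combinations are taken over Z and functions are compared on words of size n
   only. *)
Definition spanned n (F : seq bool -> seq bool -> int) (f : seq bool -> int) :=
  exists c : n.-tuple bool -> int,
    forall w : n.-tuple bool, f w = \sum_(s : n.-tuple bool) c s * F s w.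

Section Spanned.
Variables (n : nat) (F : seq bool -> seq bool -> int).

Lemma eq_spanned (f g : seq bool -> int) :
  (forall w : n.-tuple bool, f w = g w) -> spanned n F g -> spanned n F f.
Proof. by move=> eq_fg [c cP]; exists c => w; rewrite eq_fg. Qed.

Lemma spanned_row (s : n.-tuple bool) : spanned n F (F s).
Proof.
exists (fun u => (val u == val s)%:R) => w.
by rewrite (sum_delta (F^~ w)).
Qed.

(** The condition [a i != 0] lets indicator coefficients restrict a sum to some levels. *)
Lemma spanned_sum (I : finType) (a : I -> int) (f : I -> seq bool -> int) :
    (forall i, a i != 0 -> spanned n F (f i)) ->
  spanned n F (fun w => \sum_i a i * f i w).
Proof.
move=> fP.
have /fin_all_exists[c cP] i : exists c : n.-tuple bool -> int,
    forall w : n.-tuple bool, a i * f i w = \sum_(s : n.-tuple bool) c s * F s w.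
  have [->|/fP[c cP]] := eqVneq (a i) 0.
    by exists (fun _ => 0) => w; rewrite mul0r big1 // => s _; rewrite mul0r.
  exists (fun s => a i * c s) => w; rewrite cP mulr_sumr.
  by apply: eq_bigr => s _; rewrite mulrA.
exists (fun s => \sum_i c i s) => w.
under eq_bigr => i _ do rewrite cP.
by rewrite exchange_big; apply: eq_bigr => s _; rewrite mulr_suml.
Qed.

Lemma spanned_lin (a : int) f g : spanned n F f -> spanned n F g ->
  spanned n F (fun w => f w + a * g w).
Proof.
move=> fP gP.
pose h (x : bool) := if x then f else g.
apply: (@eq_spanned _ (fun w => \sum_x (if x then 1 else a) * h x w)).
  by move=> w; rewrite big_bool mul1r.
by apply: spanned_sum => -[].
Qed.

End Spanned.

(** * The rows of the symmetric chains span over Z *)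

Definition ext (x : bool) (f : seq bool -> int) (w : seq bool) : int :=
  if w is y :: w' then (x == y)%:R * f w' else 0.

Definition bot_row (s : seq bool) : seq bool -> int :=
  above (bot s) (wt s - wt (bot s)).

(* The row of false :: s has components (U_t b, U_(t-1) b) on the words starting
   with false and true.  The second one is the row of true :: s', where s' is
   the word below s in its chain. *)
Lemma spanned_bot_row n f : spanned n bot_row f.
Proof.
elim: n f => [|n IHn] f.
  exists (fun _ => f [::]) => w.
  rewrite (sum_cube0 (fun s => f [::] * bot_row s w)) (tuple0 w).
  by rewrite mulr1.
have rowT (s : n.-tuple bool) : (wt (bot s) + wt s != n)%N ->
    spanned n.+1 bot_row (ext true (bot_row s)).
  move=> neq; apply: eq_spanned (spanned_row _ [tuple of true :: s]) => w.
  case/tupleP: w => y w; rewrite /bot_row /= size_tuple neq /= !add1n subSS.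
  by case: y; rewrite ?above_TF ?above_TT ?mul1r ?mul0r.
have rowF (s : n.-tuple bool) : spanned n.+1 bot_row (ext false (bot_row s)).
  have [leb leq] := wt_bot s; rewrite size_tuple in leq.
  have sF := spanned_row bot_row [tuple of false :: s].
  have [eq_b|lt_b] := leqP (wt s) (wt (bot s)).
    apply: eq_spanned sF => w; case/tupleP: w => y w.
    rewrite /bot_row /= !add0n; have -> : (wt s - wt (bot s) = 0)%N by lia.
    by case: y; rewrite ?above_FF ?above_F0T ?mul1r ?mul0r.
  have [||s' [bots wts]] := @bot_level_tuple _ s (wt s).-1; [lia|lia|].
  have sT : spanned n.+1 bot_row (ext true (bot_row s')).
    by apply: rowT; rewrite bots wts; apply/eqP; lia.
  apply: eq_spanned (spanned_lin (-1) sF sT) => w; case/tupleP: w => y w.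
  rewrite /bot_row /= !add0n bots wts.
  have -> : (wt s - wt (bot s) = ((wt s).-1 - wt (bot s)).+1)%N by lia.
  by case: y; rewrite ?above_FF ?above_FT ?mul1r ?mul0r; ring.
have extP x : (forall s : n.-tuple bool, spanned n.+1 bot_row (ext x (bot_row s))) ->
    forall g, spanned n.+1 bot_row (ext x g).
  move=> rowP g; have [c cP] := IHn g.
  apply: (@eq_spanned _ _ _ (fun w => \sum_s c s * ext x (bot_row s) w)).
    move=> w; case/tupleP: w => y w /=; rewrite cP mulr_sumr.
    by apply: eq_bigr => s _; rewrite mulrCA.
  by apply: spanned_sum => s _; apply: rowP.
have extF := extP _ rowF.
have extT : forall g, spanned n.+1 bot_row (ext true g).
  apply: extP => s.
  have [leb leq] := wt_bot s; rewrite size_tuple in leq.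
  have [eq_n|] := eqVneq (wt (bot s) + wt s)%N n; last exact: rowT.
  (* The first 1 of [true :: s] is now unmatched, so its row starts from [false :: bot s]. Its part
     on the words starting with false is subtracted; [extF] covers every function supported
     there. *)
  apply: eq_spanned (spanned_lin (-1) (spanned_row _ [tuple of true :: s])
    (extF (above (bot s) (wt s - wt (bot s)).+1))) => w.
  case/tupleP: w => y w; rewrite /bot_row /= size_tuple eq_n eqxx /= add0n add1n.
  rewrite subSn //.
  by case: y; rewrite ?above_FF ?above_FT ?mul1r ?mul0r; ring.
apply: eq_spanned (spanned_lin 1 (extF (fun w => f (false :: w)))
  (extT (fun w => f (true :: w)))) => w; case/tupleP: w => y w /=.
by case: y; rewrite ?mul1r ?mul0r ?add0r ?addr0.
Qed.

(** * Unitriangular mixing along a chain *)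

Definition mix (a : nat -> int) (b : seq bool) (t : nat) (w : seq bool) : int :=
  \sum_(i < t.+1) a i * above b (t - i) w.

(** As [a 0 = 1], passing from the [above b t] to the [mix a b t] is unitriangular, and is inverted
    by recursion on t. *)
Lemma spanned_mix n F (a : nat -> int) b T : a 0%N = 1 ->
    (forall t, (t <= T)%N -> spanned n F (mix a b t)) ->
  forall t, (t <= T)%N -> spanned n F (above b t).
Proof.
move=> a0 mixP; elim/ltn_ind => t IHt let_T.
apply: (@eq_spanned _ _ _ (fun w => mix a b t w
    + (-1) * \sum_(i < t) a i.+1 * above b (t - i.+1) w)).
  move=> w; rewrite /mix big_ord_recl a0 subn0.
  by rewrite mulN1r addrK mul1r.
apply: spanned_lin; first exact: mixP.
by apply: spanned_sum => i _; apply: IHt; have := ltn_ord i; lia.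
Qed.

(* Row s uses the chain of s at height M - wt s, and not at the height of s, so
   that the factor t + 1 of the header becomes m - wt s. *)
Definition mixed (a : nat -> nat -> int) (M : nat) (s w : seq bool) : int :=
  if (wt s <= M)%N then mix (a (wt (bot s))) (bot s) (M - wt s) w
  else (s == w)%:R.

(** The levels <= M come from the chain rows, the levels > M from unit vectors. The bound on M makes
    every chain whose bottom b is at or below level M reach that level, so that its words up to
    level M supply all heights up to M - wt b. *)
Lemma spanned_mixed n a M f :
  (forall k, a k 0%N = 1) -> (M.*2 <= n)%N -> spanned n (mixed a M) f.
Proof.
move=> a0 leM.
have [c cP] := spanned_bot_row n f.
apply: (@eq_spanned _ _ _ (fun w =>
    \sum_(u : n.-tuple bool) ((wt u <= M)%N%:R * c u) * bot_row u w
    + 1 * \sum_(u : n.-tuple bool) ((M < wt u)%N%:R * f u) * (val u == w)%:R)).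
  move=> w; rewrite mul1r.
  under [X in _ + X]eq_bigr => u _ do rewrite mulrC.
  rewrite (sum_delta (fun u => (M < wt u)%N%:R * f u)).
  transitivity ((wt w <= M)%N%:R * f w + (M < wt w)%N%:R * f w).
    by case: leqP => _; rewrite mul1r mul0r ?addr0 ?add0r.
  congr (_ + _); rewrite cP mulr_sumr; apply: eq_bigr => u _; rewrite mulrA.
  (* [bot_row u] lives on the level of u, so cutting f to the levels <= M cuts the coefficients in
     the same way. *)
  have [->//|] := eqVneq (wt w) (wt u).
  rewrite -(subnKC (wt_bot u).1) => /above_wt eq0.
  by rewrite /bot_row eq0 !mulr0.
apply: spanned_lin; apply: spanned_sum; last first.
  move=> /= u; case: ltnP => [lt_u _|_]; last by rewrite mul0r eqxx.
  apply: eq_spanned (spanned_row _ u) => w.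
  by rewrite /mixed leqNgt lt_u.
suff rowP (u : n.-tuple bool) : (wt u <= M)%N -> spanned n (mixed a M) (bot_row u).
  by move=> u; case: leqP => [/rowP//|_]; rewrite mul0r eqxx.
move=> le_u; have [leb _] := wt_bot u.
apply: (@spanned_mix _ _ (a (wt (bot u))) _ (M - wt (bot u))); rewrite ?a0 //.
  move=> t let_M; have [||s [bots wts]] := @bot_level_tuple _ u (M - t); [lia|lia|].
  apply: eq_spanned (spanned_row _ s) => w.
  by rewrite /mixed bots wts leq_subr subKn //; lia.
exact: leq_sub2r.
Qed.

Lemma mixed_low a M (s w : seq bool) :
  (wt s <= M < wt w)%N -> mixed a M s w = 0.
Proof.
case/andP=> le_s lt_w; have [leb _] := wt_bot s.
rewrite /mixed le_s /mix big1 // => i _; rewrite above_wt ?mulr0 //.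
by apply/eqP; lia.
Qed.

(** * Binomial coefficients and the action of the operator on a chain *)

(* The coefficients of (1 - 2X)^-(r+1) and (1 - 2X)^-r.  At r = i = 0 the
   truncated predecessor gives 'C(0, 0) = 1, as it should. *)
Definition low_coef (r i : nat) : int := (2 ^ i * 'C(r + i, i))%N%:R.
Definition high_coef (r i : nat) : int := (2 ^ i * 'C((r + i).-1, i))%N%:R.

(** Compares coefficients in (1 - 2X)^-r = (1 - 2X) (1 - 2X)^-(r+1). *)
Lemma low_coefS r i :
  low_coef r i.+1 = high_coef r i.+1 + 2 * low_coef r i.
Proof.
rewrite /low_coef /high_coef -!natrM -natrD; congr _%:R.
by rewrite addnS /= binS expnS; lia.
Qed.

Lemma low_coef_ratio r i :
  i.+1%:R * low_coef r i.+1 = 2 * (r + i.+1)%:R * low_coef r i.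
Proof.
rewrite /low_coef -!natrM; congr _%:R.
have := mul_bin_diag (r + i.+1) i; rewrite {2}addnS /= expnS => eq_bin.
by rewrite mulnCA -eq_bin; ring.
Qed.

(** This compares the coefficients of [above b (t - i)] in [mix_tri]: the first term is the scalar
    of that level, with m = r + wt b, and the second is raised from the level below. *)
Lemma low_coef_high r t i :
  2 * (r%:R - t%:R + i%:R) * low_coef r i + (t%:R - i%:R) * low_coef r i.+1
    = t.+1%:R * high_coef r i.+1.
Proof.
have -> : high_coef r i.+1 = low_coef r i.+1 - 2 * low_coef r i.
  by rewrite low_coefS addrK.
have := low_coef_ratio r i; rewrite natrD -[i.+1]addn1 natrD -[t.+1]addn1 natrD.
move=> eq_ratio.
transitivity ((t%:R + 1%:R) * low_coef r (i + 1)
  - (i%:R + 1%:R) * low_coef r (i + 1)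
  + 2 * (r%:R - t%:R + i%:R) * low_coef r i); first by ring.
by rewrite eq_ratio; ring.
Qed.

Lemma mix_tri n m r t (b w : n.-tuple bool) : (r + wt b = m)%N ->
  \sum_(u : n.-tuple bool) mix (low_coef r) b t u * tri (m.*2)%:R u w
    = t.+1%:R * mix (high_coef r) b t.+1 w.
Proof.
move=> eq_m; rewrite /mix.
under eq_bigr => u _ do rewrite mulr_suml.
rewrite exchange_big /=.
under eq_bigr => i _.
  under eq_bigr => u _ do rewrite -mulrA.
  rewrite -mulr_sumr above_tri mulrDr.
  over.
rewrite big_split /=.
(* The raised terms are reindexed by their new height t + 1 - i; the added term i = t + 1
   vanishes. *)
have -> : \sum_(i < t.+1) low_coef r i * ((t - i).+1%:R * above b (t - i).+1 w)
    = \sum_(i < t.+2) low_coef r i * ((t.+1 - i)%:R * above b (t.+1 - i) w).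
  rewrite [RHS]big_ord_recr /= subnn mul0r mulr0 addr0.
  by apply: eq_bigr => i _; rewrite subSn // -ltnS.
rewrite [X in _ + X]big_ord_recl addrCA mulr_sumr [RHS]big_ord_recl /= !subn0.
congr (_ + _); first by rewrite /low_coef /high_coef !bin0; ring.
rewrite -big_split; apply: eq_bigr => i _ /=.
have le_it : (i <= t)%N by rewrite -ltnS.
rewrite /bump /= add1n subSS [RHS]mulrA -low_coef_high -eq_m -addnn !natrD natrB //.
ring.
Qed.

(** * Gluing the lower half to its reflected transpose *)

(* X is the part of the operator on the levels < m, C the complementation; P and
   Q project onto the levels >= m and > m. *)
Lemma equiv_diag_reflection N (G H E C P Q X : 'M[int]_N) :
    G \in unitmx -> G *m X = E *m H -> G *m P = P -> Q *m H = Q ->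
    X *m Q = 0 -> E *m P = 0 -> E^T = E -> P^T = P -> Q^T = Q -> C^T = C ->
    C *m C = 1%:M -> C *m Q = (1%:M - P) *m C ->
  X - C *m X^T *m C
    = (invmx G *m (C *m H^T *m C)) *m (E - C *m E *m C)
      *m (H *m (C *m (invmx G)^T *m C)).
Proof.
move=> uG eqX GP QH XQ EP trE trP trQ trC CC CQ; set K := invmx G.
have KP : K *m P = P by rewrite -{1}GP mulKmx.
have PK : P *m K^T = P by rewrite -{1}trP -trmx_mul KP.
have HQ : H^T *m Q = Q by rewrite -{1}trQ -trmx_mul QH.
have PE : P *m E = 0 by rewrite -trP -trE -trmx_mul EP trmx0.
have PC : P *m C = C *m (1%:M - Q).
  by rewrite mulmxBr CQ mulmxBl mulmx1 mul1mx subKr.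
have CP : C *m P = (1%:M - Q) *m C.
  by rewrite -[C *m P]mulmx1 -CC mulmxA -[_ *m P *m C]mulmxA PC mulmxA CC mul1mx.
have QC : Q *m C = C *m (1%:M - P) by rewrite mulmxBr CP mulmxBl mulmx1 mul1mx subKr.
have EHQ : E *m H *m Q = 0 by rewrite -eqX -mulmxA XQ mulmx0.
have QHE : Q *m H^T *m E = 0.
  by rewrite -trQ -{1}trE -!trmx_mul mulmxA EHQ trmx0.
have XE : K *m E *m H = X by rewrite -mulmxA -eqX mulKmx.
(* [E] meets only the levels < m, and [E *m H] has its columns in the levels <= m. [C] carries these
   to the levels > m and >= m, where [H] and [G] act as the identity. The next four facts follow
   this pattern. *)
have CHCE : C *m H^T *m C *m E = E.
  have CE : C *m E = Q *m C *m E.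
    by rewrite QC -mulmxA mulmxBl PE mul1mx subr0.
  by rewrite -!mulmxA CE -(mulmxA Q) (mulmxA H^T) HQ (mulmxA Q) -CE mulmxA CC mul1mx.
have EHC : E *m H *m C *m K^T *m C = E *m H.
  have -> : E *m H *m C = E *m H *m C *m P.
    by rewrite -[RHS]mulmxA CP mulmxBl mul1mx mulmxBr mulmxA EHQ mul0mx subr0.
  rewrite -(mulmxA _ P) PK -(mulmxA _ P) PC -mulmxA (mulmxA C) CC mul1mx.
  by rewrite mulmxBr mulmx1 EHQ subr0.
have ECH : E *m C *m H = E *m C.
  have EC : E *m C = E *m C *m Q.
    by rewrite -mulmxA CQ mulmxA mulmxBr EP mulmx1 subr0.
  by rewrite EC -!mulmxA QH.
have KCHE : K *m (C *m H^T *m E) = C *m H^T *m E.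
  have -> : C *m H^T *m E = P *m (C *m H^T *m E).
    by rewrite !mulmxA PC mulmxBr mulmxBl mulmx1 mulmxBl -!mulmxA (mulmxA Q) QHE
               mulmx0 subr0.
  by rewrite (mulmxA K) KP.
rewrite mulmxBr mulmxBl; congr (_ - _).
  have -> : K *m (C *m H^T *m C) *m E = K *m E.
    by rewrite -(mulmxA K) CHCE.
  rewrite -{1}XE -!(mulmxA K); congr (K *m _).
  by rewrite !mulmxA EHC.
have -> : K *m (C *m H^T *m C) *m (C *m E *m C) = C *m H^T *m E *m C.
  rewrite -KCHE -!mulmxA; do 3!congr (_ *m _).
  by rewrite (mulmxA C C) CC mul1mx.
have -> : C *m H^T *m E *m C *m (H *m (C *m K^T *m C)) = C *m H^T *m E *m K^T *m C.
  rewrite -!mulmxA (mulmxA C H) (mulmxA E) (mulmxA E) ECH.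
  by rewrite -(mulmxA E) (mulmxA C C) CC mul1mx.
by rewrite -XE !trmx_mul trE !mulmxA.
Qed.

(** * Matrices of kernels on words *)

Section Kernel.
Variables (N n : nat) (v : 'I_N -> n.-tuple bool).
Hypothesis v_bij : bijective v.

Definition kmx (F : seq bool -> seq bool -> int) : 'M[int]_N :=
  \matrix_(i, j) F (v i) (v j).

Lemma eq_kmx (F G : seq bool -> seq bool -> int) :
  (forall u w : n.-tuple bool, F u w = G u w) -> kmx F = kmx G.
Proof. by move=> eqFG; apply/matrixP=> i j; rewrite !mxE. Qed.

Lemma kmx_mul F G :
  kmx F *m kmx G = kmx (fun u w => \sum_(x : n.-tuple bool) F u x * G x w).
Proof.
apply/matrixP=> i j; rewrite !mxE (reindex v) /=; last exact: onW_bij.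
by apply: eq_bigr => k _; rewrite !mxE.
Qed.

Lemma kmx1 : kmx (fun u w => (u == w)%:R) = 1%:M.
Proof.
by apply/matrixP=> i j; rewrite !mxE val_eqE (inj_eq (bij_inj v_bij)).
Qed.

Lemma kmx_tr F : (kmx F)^T = kmx (fun u w => F w u).
Proof. by apply/matrixP=> i j; rewrite !mxE. Qed.

Lemma kmxB F G : kmx F - kmx G = kmx (fun u w => F u w - G u w).
Proof. by apply/matrixP=> i j; rewrite !mxE. Qed.

Lemma kmx0 : kmx (fun _ _ => 0) = 0.
Proof. by apply/matrixP=> i j; rewrite !mxE. Qed.

Definition kdiag (f : seq bool -> int) := kmx (fun u w => (u == w)%:R * f u).

Lemma kdiag_mul f F : kdiag f *m kmx F = kmx (fun u w => f u * F u w).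
Proof.
rewrite kmx_mul; apply: eq_kmx => u w.
rewrite -[RHS](sum_delta (fun x => f x * F x w)).
by apply: eq_bigr => x _; rewrite eq_sym; case: eqP => [->|]; rewrite ?mul0r ?mul1r.
Qed.

Lemma kdiag_tr f : (kdiag f)^T = kdiag f.
Proof.
rewrite kmx_tr; apply: eq_kmx => u w.
by rewrite eq_sym; case: eqP => [->|]; rewrite ?mul0r.
Qed.

Lemma mul_kdiag F f : kmx F *m kdiag f = kmx (fun u w => F u w * f w).
Proof.
apply: trmx_inj; rewrite trmx_mul kdiag_tr !kmx_tr kdiag_mul.
by apply: eq_kmx => u w; rewrite mulrC.
Qed.

(** Expressing the unit vectors in the rows gives an integral left inverse. *)
Lemma spanned_unitmx F : (forall f, spanned n F f) -> kmx F \in unitmx.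
Proof.
move=> Fspan.
have /fin_all_exists[c cP] (u : n.-tuple bool) :
  exists c : n.-tuple bool -> int, forall w : n.-tuple bool,
    (val u == val w)%:R = \sum_(s : n.-tuple bool) c s * F s w := Fspan (fun w => (val u == w)%:R).
pose L := \matrix_(i, j) c (v i) (v j) : 'M[int]_N.
suff /mulmx1_unit[] : L *m kmx F = 1%:M by [].
rewrite -kmx1; apply/matrixP=> i j; rewrite !mxE cP (reindex v) /=; last exact: onW_bij.
by apply: eq_bigr => k _; rewrite !mxE.
Qed.

End Kernel.

(** * Complementation and the diagonal form of the operator *)

Lemma wt_negb n (u : n.-tuple bool) : wt (map negb u) = (n - wt u)%N.
Proof.
elim: n u => [|n IHn] u; first by rewrite (tuple0 u).
case/tupleP: u => x u; rewrite /= IHn; have := wt_size u.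
by case: x => /=; lia.
Qed.

Lemma above_negb n (u w : n.-tuple bool) :
  above (map negb w) 1 (map negb u) = above u 1 w.
Proof.
rewrite /above !wt_negb; congr (_ && _)%:R.
  elim: n u w => [|n IHn] u w; first by rewrite (tuple0 u) (tuple0 w).
  case/tupleP: u => x u; case/tupleP: w => y w /=; rewrite IHn.
  by case: x; case: y.
by have := wt_size u; have := wt_size w; lia.
Qed.

(** The sign alternates with the level: in [X - C *m X^T *m C] it turns the subtracted raising term
    into an added one. The scalar 2m - 2k already changes sign under complementation. *)
Definition reflect_kernel (u w : seq bool) : int :=
  (-1) ^+ wt u * (map negb u == w)%:R.

Lemma mulr_signK a : (-1) ^+ a * (-1) ^+ a = 1 :> int.
Proof. by rewrite -exprD addnn -signr_odd odd_double. Qed.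

Section Cube.
Variables (N m : nat) (v : 'I_N -> (m.*2).-tuple bool).
Hypotheses (m_gt0 : (0 < m)%N) (v_bij : bijective v).
Local Notation kmx := (kmx v).
Local Notation kdiag := (kdiag v).

Let sign_negb (u : (m.*2).-tuple bool) : (-1) ^+ wt (map negb u) = (-1) ^+ wt u :> int.
Proof.
rewrite wt_negb -signr_odd oddB ?wt_size // odd_double addFb.
by rewrite signr_odd.
Qed.

Let C := kmx reflect_kernel.

Let mulC F : C *m kmx F = kmx (fun u w => (-1) ^+ wt u * F (map negb u) w).
Proof.
rewrite kmx_mul //; apply: eq_kmx => u w.
rewrite -[F _ _](sum_delta (F^~ w) [tuple of map negb u]) mulr_sumr.
by apply: eq_bigr => x _; rewrite /reflect_kernel eq_sym mulrA.
Qed.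

Let trC : C^T = C.
Proof.
rewrite kmx_tr; apply: eq_kmx => u w; rewrite /reflect_kernel.
have [eq_u|neq] := eqVneq (map negb w) u.
  by rewrite -eq_u (mapK negbK) sign_negb eqxx.
rewrite mulr0; case: eqP => [eq_w|]; last by rewrite mulr0.
by rewrite -eq_w (mapK negbK) eqxx in neq.
Qed.

Let CmulC F : kmx F *m C = kmx (fun u w => (-1) ^+ wt w * F u (map negb w)).
Proof. by apply: trmx_inj; rewrite trmx_mul trC !kmx_tr mulC. Qed.

Let CC : C *m C = 1%:M.
Proof.
rewrite mulC -(kmx1 v_bij); apply: eq_kmx => u w.
by rewrite /reflect_kernel (mapK negbK) sign_negb mulrA -exprD addnn -signr_odd odd_double mul1r.
Qed.

(** [G] mixes chains up to level m - 1 and [H] up to level m, the source and target levels of [X];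
    their rows above these levels are those of the identity. *)
Lemma tri_equiv_diag : exists L R : 'M[int]_N,
  [/\ L \in unitmx, R \in unitmx
    & kmx (tri (m.*2)%:R) = L *m kdiag (fun u => m%:R - (wt u)%:R) *m R].
Proof.
pose G := kmx (mixed (fun k => low_coef (m - k)) m.-1).
pose H := kmx (mixed (fun k => high_coef (m - k)) m).
pose E := kdiag (fun u => (wt u < m)%N%:R * (m%:R - (wt u)%:R)).
pose P := kdiag (fun u => (m <= wt u)%N%:R).
pose Q := kdiag (fun u => (m < wt u)%N%:R).
pose X := kmx (fun u w => (wt u < m)%N%:R * tri (m.*2)%:R u w).
have uG : G \in unitmx.
  by apply: spanned_unitmx => // f; apply: spanned_mixed => [k|]; rewrite ?/low_coef ?bin0 //; lia.
have uH : H \in unitmx.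
  by apply: spanned_unitmx => // f; apply: spanned_mixed => [k|]; rewrite ?/high_coef ?bin0.
have XE : G *m X = E *m H.
  rewrite kmx_mul // kdiag_mul //; apply: eq_kmx => u w.
  have [lt_u|le_u] := ltnP (wt u) m; last first.
    rewrite !mul0r big1 // => x _; rewrite /mixed leqNgt prednK // le_u /=.
    by case: eqP => [<-|]; rewrite ?mul0r // ltnNge le_u mul0r mulr0.
  have [leb leq] := wt_bot u.
  transitivity (\sum_(x : (m.*2).-tuple bool)
      mix (low_coef (m - wt (bot u))) (bot u) (m.-1 - wt u) x * tri (m.*2)%:R x w).
    apply: eq_bigr => x _; have [lt_x|le_x] := ltnP (wt x) m.
      by rewrite mul1r /mixed -ltnS prednK ?lt_u.
    rewrite mul0r mulr0.
    (* Cutting [X] to the levels < m loses nothing, as row u of [G] vanishes on the levels >= m. *)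
    have := @mixed_low (fun k => low_coef (m - k)) m.-1 u x.
    rewrite -ltnS prednK // lt_u le_x /mixed -ltnS prednK // lt_u => -> //.
    by rewrite mul0r.
  rewrite (@mix_tri _ m _ _ [tuple of bot u]) /=; last by lia.
  rewrite mul1r /mixed (ltnW lt_u).
  have -> : ((m.-1 - wt u).+1 = m - wt u)%N by lia.
  by rewrite natrB // ltnW.
have GP : G *m P = P.
  rewrite mul_kdiag //; apply: eq_kmx => u w.
  have [le_w|lt_w] := leqP m (wt w); last first.
    rewrite mulr0; case: eqP => [->|]; last by rewrite mul0r.
    by rewrite leqNgt lt_w mulr0.
  have [lt_u|le_u] := ltnP (wt u) m.
    rewrite mixed_low ?mul0r ?mulr0 //; lia.
  by rewrite mulr1 /mixed -ltnS prednK // ltnNge le_u mulr1.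
have QH : Q *m H = Q.
  rewrite kdiag_mul //; apply: eq_kmx => u w; rewrite /mixed.
  by case: leqP => _; rewrite ?mul0r ?mulr0 // mul1r mulr1.
have XQ : X *m Q = 0.
  rewrite mul_kdiag // -(kmx0 v); apply: eq_kmx => u w.
  case: (leqP (wt w) m) => [_|lt_w]; first by rewrite mulr0.
  case: (ltnP (wt u) m) => [lt_u|_]; last by rewrite !mul0r.
  rewrite /tri above_wt ?addr0; last by apply/eqP; lia.
  by case: eqP => [eq_uw|]; [move: lt_u lt_w; rewrite eq_uw; lia | rewrite mulr0 mulr0 mul0r].
have EP : E *m P = 0.
  rewrite mul_kdiag // -(kmx0 v); apply: eq_kmx => u w.
  by case: eqP => [->|]; case: leqP => _; rewrite ?mulr0 ?mul0r.
have trE : E^T = E by apply: kdiag_tr.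
have trP : P^T = P by apply: kdiag_tr.
have trQ : Q^T = Q by apply: kdiag_tr.
have CQ : C *m Q = (1%:M - P) *m C.
  rewrite mulmxBl mul1mx kdiag_mul // mul_kdiag // kmxB; apply: eq_kmx => u w.
  rewrite /reflect_kernel; case: eqP => [<-|]; last by rewrite !(mulr0, mul0r) subr0.
  rewrite wt_negb; have := wt_size u.
  have [le|lt] := leqP m (wt u); have [le'|lt'] := leqP (m.*2 - wt u) m => ?;
    rewrite ?mulr1 ?mulr0 ?mul0r ?mul1r ?subrr ?subr0 //; lia.
pose L := invmx G *m (C *m H^T *m C); pose R := H *m (C *m (invmx G)^T *m C).
have uC : C \in unitmx by case/mulmx1_unit: CC.
exists L, R; split.
- by rewrite /L !unitmx_mul unitmx_inv unitmx_tr uG uH uC.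
- by rewrite /R !unitmx_mul unitmx_tr unitmx_inv uG uH uC.
have -> : kmx (tri (m.*2)%:R) = X - C *m X^T *m C.
  rewrite kmx_tr mulC CmulC kmxB; apply: eq_kmx => u w.
  rewrite /tri above_negb !wt_negb.
  have le_u := wt_size u; have le_w := wt_size w.
  rewrite (inj_eq (inj_map negb_inj)) [tval w == _]eq_sym natrB //.
  have [eq_uw|neq_uw] := eqVneq (tval u) (tval w).
    rewrite -eq_uw above_wt; last by apply/eqP; lia.
    rewrite mulrA mulr_signK; move: (wt u) => a; rewrite -addnn natrD.
    case: (ltngtP a m) => [lt_u|gt_u|->].
    - have -> : (m + m - a < m)%N = false by lia.
      by rewrite /=; ring.
    - have -> : (m + m - a < m)%N by lia.
      by rewrite /=; ring.
    - by rewrite addnK ltnn /=; ring.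
  rewrite !mulr0 !add0r.
  have [eq_wt|neq_wt] := eqVneq (wt w) (wt u + 1)%N; last first.
    by rewrite above_wt // !mulr0 subr0.
  rewrite eq_wt addn1 exprS mulN1r mulNr opprK mulrA mulr_signK.
  (* Each raising step thus belongs to exactly one of the two halves. *)
  have -> : (m.*2 - (wt u).+1 < m)%N = ~~ (wt u < m)%N by lia.
  by case: (wt u < m)%N; rewrite /= !(mul1r, mul0r, addr0, add0r).
rewrite (equiv_diag_reflection uG XE GP QH XQ EP trE trP trQ trC CC CQ) -/L -/R.
congr (_ *m _ *m _); rewrite mulC CmulC kmxB; apply: eq_kmx => u w.
have le_u := wt_size u.
rewrite (inj_eq (inj_map negb_inj)); case: eqP => [<-|]; last by rewrite !mul0r !mulr0 subr0.
rewrite mulrA mulr_signK wt_negb natrB // !mul1r.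
move: (wt u) => a; rewrite -addnn natrD; case: (ltngtP a m) => [lt_u|gt_u|->].
- have -> : (m + m - a < m)%N = false by lia.
  by rewrite /=; ring.
- have -> : (m + m - a < m)%N by lia.
  by rewrite /=; ring.
- by rewrite addnK ltnn /=; ring.
Qed.

End Cube.

(** * Elementary divisors under equivalence *)

(* Some term of the Leibniz formula is prime to p. *)
Lemma unitmx_perm_coprime N (p : nat) (L : 'M[int]_N) :
    prime p -> L \in unitmx ->
  exists s : 'S_N, forall a, coprimez p (L a (s a)).
Proof.
move=> p_pr; rewrite unitmxE => uL.
have cop (x : int) : coprimez p x = ~~ (p %| x)%Z.
  by rewrite coprimezE /= prime_coprime // dvdzE.
have [s sP | noS] := pickP (fun s : 'S_N => [forall a, ~~ (p %| L a (s a))%Z]).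
  by exists s => a; rewrite cop; apply: (forallP sP).
have : (p %| \det L)%Z.
  rewrite /determinant; apply: (big_ind (fun x => (p %| x)%Z)) => [||s _]; first exact: dvdz0.
    by move=> x y; apply: rpredD.
  apply: dvdz_mull.
  have /negbT := noS s; rewrite negb_forall => /existsP[a]; rewrite negbK => pa.
  by rewrite (bigD1 a) //=; apply: dvdz_mulr.
case/orP: uL => /eqP->; rewrite dvdzE /= dvdn1 => /eqP p1;
  by rewrite p1 in p_pr.
Qed.

(** Zero entries are counted for every q, so they cancel in the difference that gives
    [elementary_divisor_mult]. *)
Definition dvd_count (q N : nat) (D : 'M[int]_N) : nat :=
  #|[set k : 'I_N | (q %| D k k)%Z]|.

(** Entrywise, L a b * D b b = E a a * R a b. Where L a (s a) is prime to p, divisibility of E a a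
    by p^i passes to the entry of D at s a, and s is injective. *)
Lemma dvd_count_le (p i N : nat) (D E L R : 'M[int]_N) :
    prime p -> is_diag_mx D -> is_diag_mx E -> L \in unitmx ->
    L *m D = E *m R ->
  (dvd_count (p ^ i) E <= dvd_count (p ^ i) D)%N.
Proof.
move=> p_pr /is_diag_mxP diagD /is_diag_mxP diagE uL eqLR.
have [s sP] := unitmx_perm_coprime p_pr uL.
rewrite /dvd_count -(card_imset _ (@perm_inj _ s)); apply: subset_leq_card.
apply/subsetP=> _ /imsetP[a + ->]; rewrite !inE => dvdE.
have entry b : L a b * D b b = E a a * R a b.
  have /matrixP/(_ a b) := eqLR; rewrite !mxE.
  rewrite (bigD1 b) //= big1 => [|c neq]; last by rewrite diagD ?mulr0 // neq.
  rewrite [in RHS](bigD1 a) //= big1 => [|c neq]; last first.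
    by rewrite diagE ?mul0r // eq_sym.
  by rewrite !addr0.
have cop : coprimez (p ^ i)%N (L a (s a)).
  by have := sP a; rewrite !coprimezE /= => cop; apply: coprimeXl.
by rewrite -(Gauss_dvdzr _ cop) entry dvdz_mulr.
Qed.

Lemma dvd_count_equiv (p i N : nat) (D E L R : 'M[int]_N) :
    prime p -> is_diag_mx D -> is_diag_mx E -> L \in unitmx -> R \in unitmx ->
    D = L *m E *m R ->
  dvd_count (p ^ i) D = dvd_count (p ^ i) E.
Proof.
move=> p_pr dD dE uL uR eqD; apply/eqP; rewrite eqn_leq.
rewrite (@dvd_count_le p i _ E D L (invmx R)) //; last by rewrite eqD mulmxK.
rewrite (@dvd_count_le p i _ D E (invmx L) R) ?unitmx_inv //.
by rewrite eqD !mulmxA mulVmx // mul1mx.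
Qed.

Lemma elementary_divisor_multE (p i N : nat) (D : 'M[int]_N) :
  elementary_divisor_mult p i D
    = (dvd_count (p ^ i) D - dvd_count (p ^ i.+1) D)%N.
Proof.
have sub : [set k | ((p ^ i.+1)%N %| D k k)%Z] \subset [set k | ((p ^ i)%N %| D k k)%Z].
  apply/subsetP=> k; rewrite !inE; apply: dvdz_trans.
  by rewrite dvdzE /= dvdn_exp2l.
rewrite /dvd_count -(cardsDS sub) /elementary_divisor_mult; congr #|pred_of_set _|.
apply/setP=> k; rewrite !inE andbC andbAC.
by case: eqP => [->|]; rewrite ?dvdz0 ?andbF ?andbT // andbC.
Qed.

(** * Characters and the spectrum *)

Definition dot (u w : seq bool) : nat := wt (map (fun p => p.1 && p.2) (zip u w)).

(** The characters of the group (Z/2)^n, which are eigenvectors of A. *)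
Definition chi (u w : seq bool) : int := (-1) ^+ dot u w.

Lemma chi_cons x y u w :
  chi (x :: u) (y :: w) = (-1) ^+ (x && y) * chi u w.
Proof. by rewrite /chi /dot /= exprD. Qed.

Lemma adj_chi (n : nat) (u w : n.-tuple bool) :
  \sum_(x : n.-tuple bool) adj u x * chi x w = (n%:R - 2 * (wt w)%:R) * chi u w.
Proof.
elim: n u w => [|n IHn] u w.
  rewrite (sum_cube0 (fun x => adj u x * chi x w)) (tuple0 u) (tuple0 w).
  by rewrite mul0r.
case/tupleP: u => x u; case/tupleP: w => y w.
rewrite (sum_cubeS (fun v => adj (x :: u) v * chi v (y :: w))) /=.
have E z : \sum_(v : n.-tuple bool) adj (x :: u) (z :: v) * chi (z :: v) (y :: w)
    = (-1) ^+ (z && y) * (if x == z then (n%:R - 2 * (wt w)%:R) * chi u w else chi u w).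
  case: ifP => [xz|nxz].
    rewrite -IHn mulr_sumr; apply: eq_bigr => v _.
    by rewrite adj_cons xz chi_cons mulrCA.
  rewrite -[chi u w](sum_delta (chi^~ w)) mulr_sumr; apply: eq_bigr => v _.
  by rewrite adj_cons nxz chi_cons eq_sym mulrCA.
rewrite !E chi_cons -[n.+1]add1n !natrD; case: (x); case: (y) => /=; ring.
Qed.

Lemma chi_chi (n : nat) (u w : n.-tuple bool) :
  \sum_(x : n.-tuple bool) chi u x * chi x w = 2 ^+ n * (val u == val w)%:R.
Proof.
elim: n u w => [|n IHn] u w.
  rewrite (sum_cube0 (fun x => chi u x * chi x w)) (tuple0 u) (tuple0 w).
  by rewrite mulr1.
case/tupleP: u => x u; case/tupleP: w => y w.
rewrite (sum_cubeS (fun v => chi (x :: u) v * chi v (y :: w))) /= eqseq_cons.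
have E z : \sum_(v : n.-tuple bool) chi (x :: u) (z :: v) * chi (z :: v) (y :: w)
    = (-1) ^+ (x && z) * (-1) ^+ (z && y) * (2 ^+ n * (val u == val w)%:R).
  by rewrite -IHn mulr_sumr; apply: eq_bigr => v _; rewrite !chi_cons mulrACA.
rewrite !E exprS; case: (x); case: (y) => /=; ring.
Qed.

(** [X] also intertwines the characteristic matrices, and its nonzero determinant cancels. *)
Lemma char_poly_intertwine (F : fieldType) N (A B X : 'M[F]_N) :
  X \in unitmx -> A *m X = X *m B -> char_poly A = char_poly B.
Proof.
move=> uX eqAB; pose X' := map_mx (@polyC F) X.
have detX : \det X' != 0.
  by rewrite det_map_mx polyC_eq0 -unitfE -unitmxE.
apply: (mulIf detX); rewrite [RHS]mulrC /char_poly -!det_mulmx; congr (\det _).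
rewrite /char_poly_mx mulmxBl mulmxBr mul_scalar_mx mul_mx_scalar.
by rewrite -!map_mxM eqAB.
Qed.

(** * Diagonal form and eigenvalues of the adjacency matrix *)

Section Main.
Variables (N m : nat) (v : 'I_N -> (m.*2).-tuple bool).
Hypotheses (m_gt0 : (0 < m)%N) (v_bij : bijective v).
Local Notation A := (adjacency_matrix (@cube_adj m.*2) v).

Lemma adjacency_kmx : A = kmx v adj.
Proof. by apply/matrixP=> i j; rewrite !mxE cube_adjE. Qed.

Lemma adjacency_equiv_diag : exists L R : 'M[int]_N,
  [/\ L \in unitmx, R \in unitmx
    & A = L *m kdiag v (fun u => m%:R - (wt u)%:R) *m R].
Proof.
have [L [R [uL uR eqT]]] := tri_equiv_diag m_gt0 v_bij.
have /mulmx1_unit[uZ uM] : kmx v zeta *m kmx v mobius = 1%:M.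
  by rewrite kmx_mul // -(kmx1 v_bij); apply: eq_kmx => u w; apply: zeta_mobius.
have eqA : A *m kmx v zeta = kmx v zeta *m kmx v (tri (m.*2)%:R).
  by rewrite adjacency_kmx !kmx_mul //; apply: eq_kmx => u w; apply: adj_zeta.
exists (kmx v zeta *m L), (R *m invmx (kmx v zeta)); split.
- by rewrite unitmx_mul uZ.
- by rewrite unitmx_mul uR unitmx_inv.
by rewrite -[LHS](mulmxK uZ) eqA eqT !mulmxA.
Qed.

Lemma perm_eigenvalues :
  perm_eq (eigenvalues A)
    [seq ((m.*2)%:R - 2 * (wt (v j))%:R)%:~R : algC | j <- enum 'I_N].
Proof.
apply: prod_XsubC_eq; rewrite -eigenvaluesP.
pose d := kdiag v (fun u => (m.*2)%:R - 2 * (wt u)%:R).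
have diag_d : is_diag_mx d.
  apply/is_diag_mxP=> i j neq; rewrite mxE val_eqE (inj_eq (bij_inj v_bij)).
  by rewrite -val_eqE (negbTE neq) mul0r.
pose X := map_mx (intr : int -> algC) (kmx v chi).
have uX : X \in unitmx.
  (* By [chi_chi] the character matrix squares to 2^(2m): it is invertible over [algC], but not over
     Z, so it cannot give the Smith form. *)
  suff /mulmx1_unit[] : X *m ((2 ^+ m.*2)^-1 *: X) = 1%:M by [].
  rewrite -scalemxAr -map_mxM kmx_mul //.
  have -> : kmx v (fun u w => \sum_(x : (m.*2).-tuple bool) chi u x * chi x w)
      = (2 ^+ m.*2)%:M.
    rewrite -[_%:M]mulmx1 -(kmx1 v_bij) mul_scalar_mx.
    by apply/matrixP=> i j; rewrite !mxE chi_chi.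
  rewrite map_scalar_mx rmorphXn /= scale_scalar_mx mulVf //.
  by rewrite expf_neq0 // pnatr_eq0.
have eqAX : map_mx intr A *m X = X *m map_mx intr d.
  rewrite -!map_mxM adjacency_kmx kmx_mul // mul_kdiag //; congr map_mx.
  by apply: eq_kmx => u w; rewrite adj_chi mulrC.
rewrite (char_poly_intertwine uX eqAX) char_poly_trig; last first.
  apply/is_trig_mxP=> i j lt_ij; rewrite mxE (is_diag_mxP diag_d) //.
  by rewrite neq_ltn lt_ij.
rewrite big_map enumT; apply: eq_bigr => j _.
by rewrite !mxE eqxx mul1r.
Qed.

End Main.

Lemma dvdC_intr (p : nat) (x : int) : (p %| (x%:~R : algC))%C = (p %| x)%Z.
Proof. by rewrite dvdC_int ?intr_int // intrKfloor dvdzE. Qed.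

Theorem corollary5p4 (n : nat) (n_gt0 : (0 < n)%N) (n_even : ~~ odd n)
    (v : 'I_(2 ^ n) -> n.-tuple bool) (v_bij : bijective v)
    (D : 'M[int]_(2 ^ n))
    (D_smith : smith_normal_form (adjacency_matrix (@cube_adj n) v) D)
    (i : nat) :
  elementary_divisor_mult 2 i D
    = eigenvalue_exact_count 2 i.+1 (adjacency_matrix (@cube_adj n) v).
Proof.
have [m def_n] : exists m, n = m.*2 by exists n./2; rewrite even_halfK.
move: (2 ^ n)%N v v_bij D D_smith => N; rewrite {}def_n in n_gt0 n_even *.
move=> v v_bij D [diagD _ [L [R [uL uR eqA]]]].
have m_gt0 : (0 < m)%N by rewrite -double_gt0.
have [L' [R' [uL' uR' eqA']]] := adjacency_equiv_diag m_gt0 v_bij.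
set E := kdiag _ _ in eqA'.
have diagE : is_diag_mx E.
  apply/is_diag_mxP=> a b neq; rewrite mxE val_eqE (inj_eq (bij_inj v_bij)).
  by rewrite -val_eqE (negbTE neq) mul0r.
have eqD : D = (invmx L *m L') *m E *m (R' *m invmx R).
  by rewrite -!mulmxA (mulmxA E) (mulmxA L') (mulmxA L') -eqA' eqA
             -!mulmxA mulmxV // mulmx1 mulmxA mulVmx // mul1mx.
have eq_mult : elementary_divisor_mult 2 i D = elementary_divisor_mult 2 i E.
  rewrite !elementary_divisor_multE.
  by rewrite !(dvd_count_equiv _ _ diagD diagE _ _ eqD) // unitmx_mul ?uL' ?uR' unitmx_inv ?uL.
rewrite eq_mult /eigenvalue_exact_count (seq.permP (perm_eigenvalues v_bij)).
rewrite count_map /elementary_divisor_mult cardE size_filter -enumT.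
apply: eq_count => j; rewrite !inE /= !dvdC_intr !mxE eqxx mul1r.
(* The eigenvalue of a vertex is twice its diagonal entry, whence the shift from i to i + 1. *)
have -> : (m.*2)%:R - 2 * (wt (v j))%:R = 2 * (m%:R - (wt (v j))%:R) :> int.
  by move: (wt _) => a; rewrite -addnn natrD; ring.
rewrite !expnS !PoszM !dvdz_mul2l //.
(* A zero entry is excluded explicitly on the left, and on the right because 0 is divisible by every
   power of 2. *)
by case: eqP => [->|//]; rewrite !dvdz0.
Qed.
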